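(* Let $\widehat{a}=a+\varepsilon b$, $a,b\in\mathbb{R}$, be a dual number with $a\neq 0,-1,-2,\dots$. Then $$\Gamma_d(\widehat{a})=\lim_{k\to\infty}k!\,k^{\widehat{a}}\bigl[\widehat{a}(\widehat{a}+1)\cdots(\widehat{a}+k)\bigr]^{-1}=\lim_{k\to\infty}k^{\widehat{a}}\,(k-1)!\,\frac{k}{\widehat{a}+k}\,\bigl[\widehat{a}(\widehat{a}+1)\cdots(\widehat{a}+k-1)\bigr]^{-1}=\lim_{k\to\infty}\frac{(k-1)!\,k^{\widehat{a}}}{(\widehat{a})_k}.$$
   Context: Dual numbers are $\widehat{x}=x_1+\varepsilon x_2$, $x_1,x_2\in\mathbb{R}$, $\varepsilon^2=0$, forming the commutative ring $\mathbb{R}[\varepsilon]/(\varepsilon^2)$; $\widehat{x}$ is invertible iff $x_1\neq0$. Limits of dual numbers are taken in the real and dual parts separately. For real $t>0$, $t^{a+\varepsilon b}=t^a(1+\varepsilon b\log t)$. The dual gamma function is $\Gamma_d(\widehat{a})=\int_0^\infty e^{-t}t^{\widehat{a}-1}\,dt$ (integrating real and dual parts) for $a>0$, which equals $\Gamma(a)+\varepsilon b\,\Gamma'(a)$; for general real $a\ne0,-1,-2,\dots$ it is given by $\Gamma_d(a+\varepsilon b)=\Gamma(a)+\varepsilon b\,\Gamma'(a)$, with $\Gamma$ the classical gamma function. The dual shifted factorial is $(\widehat{a})_0=1$, $(\widehat{a})_k=\widehat{a}(\widehat{a}+1)\cdots(\widehat{a}+k-1)$ for $k\ge1$. *)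

(* Defs.v *)
From HB Require Import structures.
From mathcomp Require Import all_boot all_order all_algebra.
From mathcomp Require Import ring.
From mathcomp Require Import all_classical all_reals all_analysis.

Set Implicit Arguments.
Unset Strict Implicit.
Unset Printing Implicit Defensive.

Import Order.TTheory GRing.Theory Num.Theory.
Import numFieldNormedType.Exports.

Local Open Scope classical_set_scope.
Local Open Scope ring_scope.

(* [Dual x1 x2] is the dual number x1 + eps x2. *)
Record dual (R : Type) := Dual { dre : R; ddu : R }.

Definition dual_pair (R : Type) (x : dual R) : R * R := (dre x, ddu x).
Definition pair_dual (R : Type) (p : R * R) : dual R := Dual p.1 p.2.

Lemma dual_pairK (R : Type) : cancel (@dual_pair R) (@pair_dual R).
Proof. by case. Qed.

HB.instance Definition _ (R : choiceType) :=
  Choice.copy (dual R) (can_type (@dual_pairK R)).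

Section DualRing.
Variable R : fieldType.
Implicit Types x y z : dual R.

Definition dual_zero : dual R := Dual 0 0.
Definition dual_opp x : dual R := Dual (- dre x) (- ddu x).
Definition dual_add x y : dual R := Dual (dre x + dre y) (ddu x + ddu y).
Definition dual_one : dual R := Dual 1 0.
Definition dual_mul x y : dual R :=
  Dual (dre x * dre y) (dre x * ddu y + ddu x * dre y).

Lemma dual_addA : associative dual_add.
Proof. by move=> x y z; rewrite /dual_add /= !addrA. Qed.

Lemma dual_addC : commutative dual_add.
Proof.
by move=> x y; rewrite /dual_add (addrC (dre x)) (addrC (ddu x)).
Qed.

Lemma dual_add0 : left_id dual_zero dual_add.
Proof. by case=> x1 x2; rewrite /dual_add /= !add0r. Qed.

Lemma dual_addN : left_inverse dual_zero dual_opp dual_add.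
Proof. by move=> x; rewrite /dual_add /= !addNr. Qed.

HB.instance Definition _ :=
  GRing.isZmodule.Build (dual R) dual_addA dual_addC dual_add0 dual_addN.

Lemma dual_mulA : associative dual_mul.
Proof. by move=> x y z; congr Dual => /=; ring. Qed.

Lemma dual_mulC : commutative dual_mul.
Proof. by move=> x y; congr Dual => /=; ring. Qed.

Lemma dual_mul1 : left_id dual_one dual_mul.
Proof. by case=> x1 x2; congr Dual => /=; ring. Qed.

Lemma dual_mulDl : left_distributive dual_mul dual_add.
Proof. by move=> x y z; congr Dual => /=; ring. Qed.

Lemma dual_one_neq0 : dual_one != 0 :> dual R.
Proof. by apply/eqP => -[] /eqP; rewrite oner_eq0. Qed.

HB.instance Definition _ :=
  GRing.Zmodule_isComNzRing.Build (dual R)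
    dual_mulA dual_mulC dual_mul1 dual_mulDl dual_one_neq0.

Definition dual_unit : {pred dual R} := fun x => dre x != 0.

(* A non-invertible element is its own inverse, as in every [unitRingType]. *)
Definition dual_inv x : dual R :=
  if dre x != 0 then Dual (dre x)^-1 (- ddu x / dre x ^+ 2) else x.

Lemma dual_mulV : {in dual_unit, left_inverse 1 dual_inv *%R}.
Proof.
move=> x; rewrite unfold_in => x1; rewrite /dual_inv x1.
by congr Dual => /=; field.
Qed.

Lemma dual_unitP x y : y * x = 1 -> dual_unit x.
Proof.
move=> [yx1 _]; apply/eqP => x1_0; move/eqP: yx1.
by rewrite x1_0 mulr0 eq_sym oner_eq0.
Qed.

Lemma dual_inv_out : {in [predC dual_unit], dual_inv =1 id}.
Proof. by move=> x; rewrite inE unfold_in /dual_inv => /negbTE ->. Qed.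

HB.instance Definition _ :=
  GRing.ComNzRing_hasMulInverse.Build (dual R)
    dual_mulV dual_unitP dual_inv_out.

Definition deps : dual R := Dual 0 1.
Definition dual_of (r : R) : dual R := Dual r 0.

Lemma dualE (x1 x2 : R) : Dual x1 x2 = dual_of x1 + deps * dual_of x2.
Proof. by congr Dual => /=; ring. Qed.

Lemma deps_sqr : deps ^+ 2 = 0.
Proof. by congr Dual => /=; ring. Qed.

Lemma dual_unitE x : (x \is a GRing.unit) = (dre x != 0).
Proof. by []. Qed.

End DualRing.

Definition shifted_factorial (A : nzRingType) (x : A) (k : nat) : A :=
  \prod_(i < k) (x + i%:R).

Section DualAnalysis.
Variable R : realType.
Implicit Types (x l : dual R) (a t : R).

Definition dual_cvg (u : nat -> dual R) l : Prop :=
  (dre (u k) @[k --> \oo] --> dre l) /\ (ddu (u k) @[k --> \oo] --> ddu l).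

Definition dual_int (D : set R) (f : R -> dual R) : dual R :=
  Dual (\int[lebesgue_measure]_(t in D) dre (f t))
       (\int[lebesgue_measure]_(t in D) ddu (f t)).

(* t ^ (x1 + eps x2) = t ^ x1 (1 + eps x2 log t), only meaningful for 0 < t. *)
Definition dual_pow t x : dual R :=
  dual_of (t `^ dre x) * (1 + deps R * dual_of (ddu x * ln t)).

Definition gamma_int a : R :=
  \int[lebesgue_measure]_(t in `]0, +oo[) (expR (- t) * t `^ (a - 1)).

(* The classical gamma function, extended from a > 0 by the recurrence
   Gamma(a) = Gamma(a + n) / (a (a + 1) ... (a + n - 1)), where n is 0 if
   0 < a and is large enough for 0 < a + n otherwise.  At the poles
   0, -1, -2, ... the denominator vanishes and the value is 0. *)
Definition gamma_shift a : nat := if 0 < a then 0%N else (Num.truncn (- a)).+1.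

Definition gamma a : R :=
  gamma_int (a + (gamma_shift a)%:R) / shifted_factorial a (gamma_shift a).

Definition dual_gamma x : dual R :=
  if 0 < dre x then
    dual_int `]0, +oo[ (fun t => dual_of (expR (- t)) * dual_pow t (x - 1))
  else dual_of (gamma (dre x)) + deps R * dual_of (ddu x * derive1 gamma (dre x)).

End DualAnalysis.

(* Main.v *)
Require Import Defs.
From mathcomp Require Import all_boot all_order all_algebra.
From mathcomp Require Import zify ring lra.
From mathcomp Require Import all_classical all_reals all_analysis.
From mathcomp Require Import measurable_realfun.
Import Order.TTheory GRing.Theory Num.Theory.
Import numFieldNormedType.Exports.

(** Write [G_k x] for the Gauss product [k! k^x / (x (x + 1) ... (x + k))]. The
    three sequences differ from one another by factors equal to [1] or to
    [(x + k) / k], which tends to [1], so everything reduces to the convergence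
    of [G_k x] to the dual gamma value.

    The dual part of [G_k (a + eps b)] is [b] times the derivative of [G_k] at
    [a], that is, [b G_k(a) (ln k - sum_(i <= k) 1 / (a + i))]. For [0 < a] one
    therefore needs two real limits: [G_k a] tends to [Gamma a], and
    [ln k - sum_(i <= k) 1 / (a + i)] tends to the digamma value
    [Gamma' a / Gamma a].

    Both follow from log-convexity of the Euler integral. Integrating
    [e^y >= 1 + y] against the Euler kernel gives, with [psi] the quotient of
    the integral of [e^-t t^(c-1) ln t] by [Gamma c], the tangent inequality
    [Gamma c * e^((s - c) psi c) <= Gamma s] ([gamma_int_log_tangent]). Together
    with the recurrence [Gamma (c + 1) = c Gamma c] it yields
    [psi c <= ln c <= psi (c + 1)]. The tangents at [k + 1] and [a + k + 1] then
    squeeze [G_k a] ([cvg_gauss_gamma]), and [psi (c + 1) = psi c + 1 / c]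
    squeezes the harmonic-like sum ([cvg_digamma]). The last identity is the
    derivative of the recurrence, since [Gamma] may be differentiated under the
    integral sign ([is_derive_gamma_int]).

    If [a < 0], the relation [G_k x = G_k (x + 1) x^-1 (x + 1 + k) / k] in the
    ring of dual numbers carries the limit from [x + n] down to [x]
    ([cvg_dual_gauss]). On the other side [gamma] is, near [a], the quotient of
    [Gamma (t + n)] by a shifted factorial; the dual number formed by a function
    value and its derivative is multiplicative, so the same quotient in the dual
    numbers is the dual gamma value ([dual_gammaE]). *)

Set Implicit Arguments.
Unset Strict Implicit.
Unset Printing Implicit Defensive.

Local Open Scope classical_set_scope.
Local Open Scope ring_scope.

(** * The Euler kernel *)

Section EulerKernel.
Variable R : realType.
Implicit Types (p c s t u v : R) (n : nat).

Local Notation mu := (@lebesgue_measure R).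

Definition euler_kernel p t := expR (- t) * t `^ (p - 1).

Lemma powR_expR_ln t u : 0 < t -> t `^ u = expR (u * ln t).
Proof. by move=> t0; rewrite /powR gt_eqF. Qed.

Lemma euler_kernel_ge0 p t : 0 <= euler_kernel p t.
Proof. by rewrite mulr_ge0 ?expR_ge0 ?powR_ge0. Qed.

Lemma measurable_euler_kernel p (D : set R) : measurable_fun D (euler_kernel p).
Proof.
apply: measurable_funTS; apply: measurable_funM; last exact: measurable_powR.
by apply: measurableT_comp => //; exact: measurable_expR.
Qed.

(** Powers are absorbed by exponentials: [ln y <= y] at [y = t / m] gives
    [(t / m) `^ c <= expR (c * t / m)], and [m = 2 (c + 1)] makes the rate
    [c / m] at most [1 / 2]. *)
Lemma powR_le_expR_half c : 0 <= c ->
  exists2 M, 0 < M & forall t, 0 < t -> t `^ c <= M * expR (t / 2).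
Proof.
move=> c0; pose m := 2 * (c + 1).
have m0 : 0 < m by rewrite /m; lra.
exists (m `^ c); first exact: powR_gt0.
move=> t t0; have tm0 : 0 < t / m by rewrite divr_gt0.
rewrite -{1}(divfK (lt0r_neq0 m0) t).
rewrite powRM ?(ltW tm0) ?(ltW m0)// mulrC ler_wpM2l ?powR_ge0//.
rewrite powR_expR_ln// ler_expR.
have lnt : ln (t / m) <= t / m.
  by rewrite -ler_expR lnK ?posrE//; have := expR_ge1Dx (t / m); lra.
apply: (le_trans (ler_wpM2l c0 lnt)).
rewrite /m mulrCA (ler_wpM2l (ltW t0))// ler_pdivrMr; lra.
Qed.

Lemma euler_kernel_le p : 1 <= p -> exists2 M, 0 < M &
  forall t, 0 < t -> euler_kernel p t <= M * expR (- (t / 2)).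
Proof.
move=> p1; have [|M M0 HM] := @powR_le_expR_half (p - 1); first by rewrite subr_ge0.
exists M => // t t0.
rewrite /euler_kernel mulrC (_ : - (t / 2) = t / 2 + - t); last by field.
by rewrite expRD mulrA ler_wpM2r ?expR_ge0 ?HM.
Qed.

(** For [1 <= p] there is no singularity at [0], and the exponential density of
    rate [1 / 2] dominates. The range [0 < p < 1] is reached later by the
    recurrence. *)
Lemma integrable_euler_kernel_ge1 p : 1 <= p ->
  mu.-integrable `]0, +oo[ (EFin \o euler_kernel p).
Proof.
move=> p1; have [M M0 HM] := euler_kernel_le p1.
have h0 : 0 < 2^-1 :> R by lra.
have iT := integrable_exponential_pdf h0.
have iD : mu.-integrable `]0, +oo[ (EFin \o exponential_pdf (2^-1 : R)).
  by apply: (integrableS _ _ _ iT) => //; exact: measurable_itv.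
have iM : mu.-integrable `]0, +oo[
    (fun t => ((M * 2)%:E * (EFin \o exponential_pdf (2^-1 : R)) t)%E).
  by apply: integrableZl iD; exact: measurable_itv.
apply: le_integrable iM => //.
  by apply/measurable_EFinP; exact: measurable_euler_kernel.
move=> t /=; rewrite in_itv/= andbT => t0.
rewrite lee_fin ger0_norm ?euler_kernel_ge0//.
apply: le_trans (HM t t0) _; apply: le_trans (ler_norm _).
rewrite exponential_pdfE ?(ltW t0)//.
rewrite le_eqVlt; apply/orP; left; apply/eqP.
rewrite (_ : - 2^-1 * t = - (t / 2)); last by field.
by field.
Qed.

(** The fundamental theorem of calculus for [e^-t t^c], on a compact interval
    that avoids the singularity of the integrand at [0]. *)
Lemma euler_kernel_parts c u v : 0 < u -> u < v ->
  (\int[mu]_(t in `[u, v]) (c * euler_kernel c t - euler_kernel (c + 1) t)%:E =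
   (euler_kernel (c + 1) v - euler_kernel (c + 1) u)%:E)%E.
Proof.
move=> u0 uv.
pose f (t : R) : R := c * euler_kernel c t - euler_kernel (c + 1) t.
have dF t : 0 < t -> is_derive t (1 : R) (euler_kernel (c + 1)) (f t).
  move=> t0.
  have := is_derive1_powR c t0 => dp.
  have -> : euler_kernel (c + 1) = (expR \o -%R) * (fun t : R => t `^ c).
    by apply/funext => x; rewrite /euler_kernel addrK.
  apply: is_derive_eq.
  rewrite /f /euler_kernel /= addrK /GRing.scale /=; ring.
have df t : 0 < t -> derivable f t (1 : R).
  move=> t0.
  have := is_derive1_powR (c-1) t0 => dp.
  have := is_derive1_powR c t0 => dp1.
  have -> : f = (cst c * (expR \o -%R) * (fun t : R => t `^ (c - 1)))
    - (expR \o -%R) * (fun t : R => t `^ c).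
    by apply/funext => x; rewrite /f /euler_kernel addrK /= !fctE mulrA.
  exact: ex_derive.
rewrite (@continuous_FTC2 _ f (euler_kernel (c + 1)))//.
- apply: derivable_within_continuous => t; rewrite in_itv/= => /andP[ut _].
  by apply: df; apply: lt_le_trans ut.
- have ct t : 0 < t -> {for t, continuous (euler_kernel (c + 1))}.
    move=> t0; apply/differentiable_continuous/derivable1_diffP.
    exact: (@ex_derive _ _ _ _ _ _ _ (dF t t0)).
  split.
  + move=> t; rewrite in_itv/= => /andP[ut _].
    exact: (@ex_derive _ _ _ _ _ _ _ (dF t (lt_trans u0 ut))).
  + by apply/cvg_at_right_filter; exact: ct.
  + by apply/cvg_at_left_filter; apply: ct; apply: lt_trans uv.
- move=> t; rewrite in_itv/= => /andP[ut _].
  by rewrite derive1E; apply: (@derive_val _ _ _ _ _ _ _ (dF t (lt_trans u0 ut))).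
Qed.

End EulerKernel.

(** * The Euler integral and its recurrence *)

Section EulerIntegral.
Variable R : realType.
Implicit Types (p c s t u v : R) (n : nat).

Local Notation mu := (@lebesgue_measure R).

Lemma euler_kernelS c t : 0 < t -> euler_kernel (c + 1) t = t * euler_kernel c t.
Proof.
move=> t0; rewrite /euler_kernel addrK mulrCA; congr (_ * _).
by rewrite -{2}(powRr1 (ltW t0)) -powRD ?(gt_eqF t0) ?implybT// addrC subrK.
Qed.

Lemma integrable_euler_kernel_segment c u v : 0 < c -> 0 < u ->
  mu.-integrable `[u, v] (EFin \o euler_kernel c).
Proof.
move=> c0 u0.
have c1 : 1 <= c + 1 by lra.
have iS : mu.-integrable `[u, v] (EFin \o euler_kernel (c + 1)).
  apply: (integrableS _ _ _ (integrable_euler_kernel_ge1 c1)) => //.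
  by move=> t /=; rewrite !in_itv/= andbT => /andP[ut _]; exact: lt_le_trans ut.
have iM : mu.-integrable `[u, v]
    (fun t => (u^-1%:E * (EFin \o euler_kernel (c + 1)) t)%E).
  by apply: integrableZl iS; exact: measurable_itv.
apply: le_integrable iM => //.
  by apply/measurable_EFinP; exact: measurable_euler_kernel.
move=> t /=; rewrite in_itv/= => /andP[ut _].
have t0 := lt_le_trans u0 ut.
rewrite lee_fin !ger0_norm ?euler_kernel_ge0//; last first.
  by rewrite mulr_ge0 ?euler_kernel_ge0 ?invr_ge0 ?(ltW u0).
rewrite euler_kernelS// mulrA -[leLHS]mul1r ler_wpM2r ?euler_kernel_ge0//.
by rewrite mulrC ler_pdivlMr// mul1r.
Qed.

(** Compact intervals that exhaust the open half-line, on which the improper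
    integral is computed by monotone convergence. *)
Definition segment n : set R := `[(n.+2%:R)^-1, n.+2%:R]%classic.

Lemma bigcup_segments_itv0y :
  \bigcup_n segment n = `]0, +oo[%classic.
Proof.
apply/seteqP; split => [t [n _]|t]; rewrite /segment /= !in_itv/= andbT.
  by move=> /andP[+ _]; apply: lt_le_trans; rewrite invr_gt0.
move=> t0.
have [n nt] : exists n, t + t^-1 < n%:R.
  exists (Num.truncn (t + t^-1)).+1; apply: truncnS_gt.
exists n => //; rewrite /segment /= in_itv/=; apply/andP; split.
  rewrite -[leRHS]invrK lef_pV2 ?posrE ?invr_gt0//.
  apply: (@le_trans _ _ (t + t^-1)); first by rewrite lerDr ltW.
  by apply: le_trans (ltW nt) _; rewrite ler_nat; lia.
apply: (@le_trans _ _ (t + t^-1)); first by rewrite lerDl invr_ge0 ltW.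
by apply: le_trans (ltW nt) _; rewrite ler_nat; lia.
Qed.

Lemma cvg_segments_euler_kernel c :
  (\int[mu]_(t in segment n) (euler_kernel c t)%:E)%E
    @[n --> \oo] --> (\int[mu]_(t in `]0%R, +oo[) (euler_kernel c t)%:E)%E.
Proof.
rewrite -bigcup_segments_itv0y.
apply: ge0_nondecreasing_set_cvg_integral.
- move=> m n mn; apply/subsetPset => t; rewrite /segment /= !in_itv/= => /andP[h1 h2].
  apply/andP; split.
    by apply: le_trans h1; rewrite lef_pV2 ?posrE// ler_nat; lia.
  by apply: le_trans h2 _; rewrite ler_nat; lia.
- by move=> n; exact: measurable_itv.
- by move=> n; apply/measurable_EFinP; exact: measurable_euler_kernel.
- by move=> n t _; rewrite lee_fin euler_kernel_ge0.
Qed.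

Lemma cvg_euler_kernel_pinfty c : 1 <= c ->
  euler_kernel c n.+2%:R @[n --> \oo] --> 0.
Proof.
move=> c1; have [M M0 HM] := euler_kernel_le c1.
have cM : M * 2 * n.+1%:R^-1 @[n --> \oo] --> 0.
  by rewrite -(mulr0 (M * 2)); apply: cvgMr; exact: cvg_harmonic.
apply: (squeeze_cvgr _ (cvg_cst 0) cM); apply: nearW => n.
rewrite euler_kernel_ge0/=; apply: (le_trans (HM _ _)) => //.
rewrite -mulrA (ler_wpM2l (ltW M0))// expRN -[leRHS]invrK lef_pV2 ?posrE ?expR_gt0//.
rewrite invfM invrK mulrC.
apply: (@le_trans _ _ (n.+2%:R / 2)); last first.
  by have := expR_ge1Dx (n.+2%:R / 2 : R); lra.
by rewrite ler_wpM2r// ler_nat.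
Qed.

Lemma cvg_euler_kernel_0 c : 0 < c ->
  euler_kernel (c + 1) (n.+2%:R^-1) @[n --> \oo] --> 0.
Proof.
move=> c0.
have cM : ((n.+2%:R)^-1 : R) `^ c @[n --> \oo] --> 0.
  move/cvg_at_rightP: (powR_cvg0 c0) => /(_ (fun n => (n.+2%:R)^-1)); apply.
  split=> [n|]; first by rewrite invr_gt0.
  by rewrite (cvg_shiftS (fun n => n.+1%:R^-1 : R)); exact: cvg_harmonic.
apply: (squeeze_cvgr _ (cvg_cst 0) cM).
apply: nearW => n; rewrite euler_kernel_ge0/= /euler_kernel addrK.
by rewrite -[leRHS]mul1r ler_wpM2r ?powR_ge0// -expR0 ler_expR oppr_le0 invr_ge0.
Qed.

(** [Gamma (c + 1) = c Gamma c] in the extended reals: the boundary terms of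
    the integration by parts over [segment n] vanish in the limit. In this form
    the equality also yields the finiteness of the right-hand integral, which
    is what gives integrability for [0 < c < 1]. *)
Lemma integral_euler_kernelS c : 0 < c ->
  (\int[mu]_(t in `]0%R, +oo[) (euler_kernel (c + 1) t)%:E =
   c%:E * \int[mu]_(t in `]0%R, +oo[) (euler_kernel c t)%:E)%E.
Proof.
move=> c0.
pose d n := euler_kernel (c + 1) n.+2%:R - euler_kernel (c + 1) n.+2%:R^-1.
have step n : (c%:E * \int[mu]_(t in segment n) (euler_kernel c t)%:E =
    \int[mu]_(t in segment n) (euler_kernel (c + 1) t)%:E + (d n)%:E)%E.
  have n1 : (1 : R) < n.+2%:R by rewrite ltr1n.
  have u0 : 0 < (n.+2%:R : R)^-1 by rewrite invr_gt0.
  have uv : (n.+2%:R : R)^-1 < n.+2%:R by apply: lt_trans n1; rewrite invf_lt1 ?ltr1n.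
  have := euler_kernel_parts c u0 uv; rewrite -/(segment n).
  have i1 : mu.-integrable (segment n) (EFin \o (fun t => c * euler_kernel c t)).
    exact: (integrableZl _ _ (integrable_euler_kernel_segment _ c0 u0)).
  have c1 : 0 < c + 1 by lra.
  under eq_integral do rewrite EFinB.
  rewrite integralB_EFin//; last 2 first.
    exact: measurable_itv.
    exact: integrable_euler_kernel_segment.
  move=> <-; rewrite addeC subeK; last first.
    apply: integrable_fin_num; first exact: measurable_itv.
    exact: integrable_euler_kernel_segment.
  under [RHS]eq_integral do rewrite EFinM.
  by rewrite integralZl//; [exact: measurable_itv|exact: integrable_euler_kernel_segment].
have cd : (d n)%:E @[n --> \oo] --> 0%:E.
  apply/cvg_EFin; first by apply: nearW.
  rewrite -(subr0 0); apply: cvgB.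
    by apply: cvg_euler_kernel_pinfty; lra.
  exact: cvg_euler_kernel_0.
have cl := cvgeZl (isT : c%:E \is a fin_num) (@cvg_segments_euler_kernel c).
have cr := cvgeD (fin_num_adde_defl _ (erefl : 0%:E \is a fin_num))
  (@cvg_segments_euler_kernel (c + 1)) cd.
rewrite adde0 in cr.
rewrite (funext step) in cl.
exact: (cvg_unique (@ereal_hausdorff R) (cr eventually_filter) cl).
Qed.

Lemma integrable_euler_kernel p : 0 < p ->
  mu.-integrable `]0, +oo[ (EFin \o euler_kernel p).
Proof.
move=> p0.
apply/integrableP; split.
  by apply/measurable_EFinP; exact: measurable_euler_kernel.
under eq_integral do rewrite /= ger0_norm ?euler_kernel_ge0//.
rewrite ltey_eq; apply/orP; left.
have /integrable_fin_num : mu.-integrable `]0, +oo[ (EFin \o euler_kernel (p + 1)).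
  by apply: integrable_euler_kernel_ge1; lra.
move=> /(_ (measurable_itv _)); rewrite integral_euler_kernelS//.
by case: (\int[mu]_(t in _) _)%E => [r||]//; rewrite ?gt0_muley ?gt0_muleNy ?lte_fin.
Qed.

Lemma gamma_intS c : 0 < c -> gamma_int (c + 1) = c * gamma_int c.
Proof.
move=> c0; rewrite /gamma_int /Rintegral.
rewrite -/(euler_kernel _) integral_euler_kernelS// fineM//.
by apply: integrable_fin_num; [exact: measurable_itv|exact: integrable_euler_kernel].
Qed.

Lemma gamma_int1 : gamma_int (1 : R) = 1.
Proof.
rewrite /gamma_int /Rintegral.
have -> : (\int[mu]_(t in `]0%R, +oo[) (expR (- t) * t `^ (1 - 1))%:E = 1)%E; last by [].
rewrite (@integral_itv_obnd_cbnd _ _ _ (EFin \o euler_kernel 1)); last first.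
  by apply/measurable_EFinP; exact: measurable_euler_kernel.
rewrite -(integral_exponential_pdf (@ltr01 R)) /exponential_pdf.
rewrite -[RHS](_ : (\int[mu]_(t in `[0%R, +oo[) (1 * expR (- 1 * t))%:E)%E = _).
  by apply: eq_integral => t _; rewrite /= /euler_kernel subrr powRr0 mulr1 mul1r mulN1r.
by rewrite integral_mkcond restrict_EFin.
Qed.

End EulerIntegral.

(** * The derivative of the Euler integral *)

Section LogarithmicMoment.
Variable R : realType.
Implicit Types (p c s t u v : R) (n : nat).

Local Notation mu := (@lebesgue_measure R).

(** The integral obtained by differentiating [gamma_int] under the integral
    sign. *)
Definition gamma_log_int c : R :=
  \int[mu]_(t in `]0, +oo[) (euler_kernel c t * ln t).

Lemma measurable_euler_kernel_ln c (D : set R) :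
  measurable_fun D (fun t => euler_kernel c t * ln t).
Proof.
apply: measurable_funTS; apply: measurable_funM; last exact: measurable_ln.
exact: measurable_euler_kernel.
Qed.

Lemma euler_kernel_expR c s t : 0 < t ->
  euler_kernel s t = euler_kernel c t * expR ((s - c) * ln t).
Proof.
move=> t0; rewrite /euler_kernel !powR_expR_ln// -!expRD; congr expR; ring.
Qed.

(** [d |ln t| <= t^d + t^-d] trades the logarithm for a shift of the exponent
    by [d] either way; [d = c / 2] keeps both exponents positive. *)
Lemma integrable_euler_kernel_ln c : 0 < c ->
  mu.-integrable `]0, +oo[ (EFin \o (fun t => euler_kernel c t * ln t)).
Proof.
move=> c0; pose d := c / 2.
have d0 : 0 < d by rewrite /d; lra.
have iS : mu.-integrable `]0, +oo[
    ((EFin \o euler_kernel (c + d)) \+ (EFin \o euler_kernel (c - d))).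
  by apply: integrableD => //; apply: integrable_euler_kernel; rewrite /d; lra.
have iM : mu.-integrable `]0, +oo[ (fun t => (d^-1)%:E *
    ((EFin \o euler_kernel (c + d)) \+ (EFin \o euler_kernel (c - d))) t)%E.
  by apply: integrableZl iS; exact: measurable_itv.
apply: le_integrable iM => //.
  by apply/measurable_EFinP; exact: measurable_euler_kernel_ln.
move=> t /=; rewrite in_itv/= andbT => t0.
rewrite lee_fin normrM ger0_norm ?euler_kernel_ge0//.
apply: le_trans (ler_norm _).
rewrite (euler_kernel_expR c (c + d) t0) (euler_kernel_expR c (c - d) t0).
rewrite -mulrDr mulrCA ler_wpM2l ?euler_kernel_ge0//.
rewrite -(ler_pM2l d0) mulVKf ?gt_eqF// -{1}(gtr0_norm d0) -normrM.
have -> : c + d - c = d by ring.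
have -> : (c - d - c) * ln t = - (d * ln t) by ring.
set x := d * ln t.
have := expR_ge1Dx x; have := expR_ge1Dx (- x).
have := expR_gt0 x; have := expR_gt0 (- x).
by case: (lerP 0 x) => ?; [rewrite ger0_norm|rewrite ltr0_norm]; lra.
Qed.

(** Integrating [expR y >= 1 + y] at [y = (s - c) (ln t - m)] against the kernel
    of parameter [c]. The free parameter [m] is a rescaling of [t]: choosing it
    well turns this convexity inequality into log-convexity. *)
Lemma gamma_int_tangent c s m : 0 < c -> 0 < s ->
  expR ((s - c) * m) * ((1 - (s - c) * m) * gamma_int c
                        + (s - c) * gamma_log_int c) <= gamma_int s.
Proof.
move=> c0 s0; set h := s - c; set e := expR _.
have mI : measurable (`]0, +oo[ : set R) by exact: measurable_itv.
have iK := integrable_euler_kernel c0.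
have iL := integrable_euler_kernel_ln c0.
have i1 : mu.-integrable `]0, +oo[
    (EFin \o (fun t => (e * (1 - h * m)) * euler_kernel c t)).
  exact: (integrableZl _ _ iK).
have i2 : mu.-integrable `]0, +oo[
    (EFin \o (fun t => (e * h) * (euler_kernel c t * ln t))).
  exact: (integrableZl _ _ iL).
have -> : e * ((1 - h * m) * gamma_int c + h * gamma_log_int c) =
  \int[mu]_(t in `]0, +oo[)
    ((e * (1 - h * m)) * euler_kernel c t + (e * h) * (euler_kernel c t * ln t)).
  by rewrite RintegralD// !RintegralZl// mulrDr !mulrA.
apply: le_Rintegral => //.
- exact: (integrableD _ i1 i2).
- exact: integrable_euler_kernel.
move=> t /=; rewrite in_itv/= andbT => t0.
rewrite -/(euler_kernel s t) (euler_kernel_expR c s t0) -/h.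
have -> : e * (1 - h * m) * euler_kernel c t + e * h * (euler_kernel c t * ln t) =
  euler_kernel c t * (e * (1 + (h * (ln t - m)))) by ring.
rewrite ler_wpM2l ?euler_kernel_ge0//.
have -> : h * ln t = h * m + h * (ln t - m) by ring.
by rewrite expRD ler_wpM2l ?expR_ge0 ?expR_ge1Dx.
Qed.

(** With base point [1] and [m = gamma_log_int 1] the lower bound of
    [gamma_int_tangent] is an exponential. *)
Lemma gamma_int_gt0 c : 0 < c -> 0 < gamma_int c.
Proof.
move=> c0; apply: lt_le_trans (gamma_int_tangent (gamma_log_int 1) ltr01 c0).
by rewrite gamma_int1 mulr1 subrK mulr1 expR_gt0.
Qed.

(** The derivatives of the kernels with parameter in a neighbourhood
    [`]u, v[] of [c] are dominated by the sum of the two extreme ones, since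
    [t `^ x] is monotone in [x] in a direction that depends on [t]. *)
Lemma is_derive_gamma_int c : 0 < c ->
  is_derive c (1 : R) (@gamma_int R) (gamma_log_int c).
Proof.
move=> c0; pose u := c / 2; pose v := 2 * c.
have u0 : 0 < u by rewrite /u; lra.
have v0 : 0 < v by rewrite /v; lra.
have uv x : `]u, v[%classic x -> 0 < x.
  by rewrite /= in_itv/= => /andP[ux _]; exact: lt_trans ux.
pose G t := `|euler_kernel u t * ln t| + `|euler_kernel v t * ln t|.
have cuv : `]u, v[%classic c by rewrite /= in_itv/= /u /v; apply/andP; split; lra.
have dK x t : 0 < t ->
    is_derive x (1 : R) ((@euler_kernel R) ^~ t) (euler_kernel x t * ln t).
  move=> t0.
  have -> : (@euler_kernel R) ^~ t =
    cst (expR (- t)) * (expR \o (fun x : R => (x - 1) * ln t)).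
    by apply/funext => y; rewrite /euler_kernel powR_expR_ln.
  apply: is_derive_eq.
  rewrite /euler_kernel powR_expR_ln//= /GRing.scale/=; ring.
have pK x t : 0 < t -> partial1of2 (@euler_kernel R) x t = euler_kernel x t * ln t.
  by move=> t0; rewrite partial1of2E; apply: (@derive_val _ _ _ _ _ _ _ (dK x t t0)).
have iK x : `]u, v[%classic x -> mu.-integrable `]0, +oo[ (EFin \o euler_kernel x).
  by move=> /uv; exact: integrable_euler_kernel.
have dK' (x t : R) : `]u, v[%classic x -> `]0, +oo[%classic t ->
    derivable ((@euler_kernel R) ^~ t) x 1.
  rewrite /= [in X in _ -> X -> _]in_itv/= andbT => _ t0.
  exact: (@ex_derive _ _ _ _ _ _ _ (dK x t t0)).
have iG : mu.-integrable `]0, +oo[ (EFin \o G).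
  have iuv := integrableD _
    (integrable_abse (integrable_euler_kernel_ln u0))
    (integrable_abse (integrable_euler_kernel_ln v0)).
  exact: iuv.
have G0 t : 0 <= G t by rewrite addr_ge0.
have GK (x t : R) : `]u, v[%classic x -> `]0, +oo[%classic t ->
    `|partial1of2 (@euler_kernel R) x t| <= G t.
  rewrite /= !in_itv/= andbT => /andP[ux xv] t0.
  rewrite pK// /G !normrM -mulrDl ler_wpM2r//.
  rewrite !ger0_norm ?expR_ge0 ?powR_ge0// -!/(euler_kernel _ _).
  rewrite (euler_kernel_expR x u t0) (euler_kernel_expR x v t0) -mulrDr.
  rewrite ler_peMr ?euler_kernel_ge0//.
  have [l0|l0] := lerP 0 (ln t).
    have : 1 <= expR ((v - x) * ln t) by rewrite -expR0 ler_expR mulr_ge0// subr_ge0 ltW.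
    by have := expR_gt0 ((u - x) * ln t); lra.
  have : 1 <= expR ((u - x) * ln t).
    by rewrite -expR0 ler_expR mulr_le0 ?subr_le0 ?ltW.
  by have := expR_gt0 ((v - x) * ln t); lra.
have mI : measurable (`]0, +oo[ : set R) by exact: measurable_itv.
have D := derivable_under_integral _ cuv iK dK' G0 iG GK.
have E := differentiation_under_integral _ cuv iK dK' G0 iG GK.
apply: DeriveDef; first exact: (D mI).
rewrite -derive1E; apply: etrans (E mI) _.
apply: eq_Rintegral => t; rewrite inE/= in_itv/= andbT => t0.
exact: pK.
Qed.

(** Both sides are the derivative at [c] of [gamma_int (x + 1)], which is
    [x * gamma_int x] near [c]. *)
Lemma gamma_log_intS c : 0 < c ->
  gamma_log_int (c + 1) = gamma_int c + c * gamma_log_int c.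
Proof.
move=> c0.
have d1 := is_derive_gamma_int c0.
have c1 : 0 < c + 1 by lra.
have d2 := is_derive_gamma_int c1.
have d3 : is_derive c (1 : R) (fun x => gamma_int (x + 1)) (gamma_log_int (c + 1)).
  have dg : is_derive c (1 : R) (fun x : R => x + 1) 1.
    by apply: is_derive_eq; rewrite addr0.
  have := @is_derive1_comp _ (@gamma_int R) (fun x : R => x + 1) _ _ _ d2 dg.
  by rewrite mulr1.
have d4 : is_derive c (1 : R) (fun x => gamma_int (x + 1))
    (gamma_int c + c * gamma_log_int c).
  apply: (@near_eq_is_derive _ _ _ (id * (@gamma_int R))).
    near=> x; rewrite gamma_intS//; near: x; exact: lt_nbhsr.
  apply: is_derive_eq.
  by rewrite /GRing.scale/= mulr1 addrC.
by rewrite -(@derive_val _ _ _ _ _ _ _ d3) (@derive_val _ _ _ _ _ _ _ d4).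
Unshelve. end_near. Qed.

End LogarithmicMoment.

(** * Log-convexity and the real Gauss limits *)

Section GaussLimit.
Variable R : realType.
Implicit Types (a c s : R) (n : nat).

Definition digamma c : R := gamma_log_int c / gamma_int c.

(** Log-convexity: [digamma c] is the value of [m] that makes the linear factor
    in [gamma_int_tangent] equal to [gamma_int c]. *)
Lemma gamma_int_log_tangent c s : 0 < c -> 0 < s ->
  gamma_int c * expR ((s - c) * digamma c) <= gamma_int s.
Proof.
move=> c0 s0; apply: le_trans (gamma_int_tangent (digamma c) c0 s0).
rewrite mulrC ler_wpM2l ?expR_ge0// le_eqVlt; apply/orP; left; apply/eqP.
rewrite /digamma; field; exact: lt0r_neq0 (gamma_int_gt0 c0).
Qed.

(** The log-tangent at [c], evaluated at [c + 1], where [gamma_int (c + 1)] is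
    [c * gamma_int c]. *)
Lemma digamma_le_ln c : 0 < c -> digamma c <= ln c.
Proof.
move=> c0; have c1 : 0 < c + 1 by lra.
have := gamma_int_log_tangent c0 c1.
rewrite addrAC subrr add0r mul1r gamma_intS// mulrC.
rewrite ler_pM2r ?gamma_int_gt0// => h.
by rewrite -ler_expR lnK ?posrE.
Qed.

(** The log-tangent at [c + 1], evaluated at [c]. *)
Lemma ln_le_digammaS c : 0 < c -> ln c <= digamma (c + 1).
Proof.
move=> c0; have c1 : 0 < c + 1 by lra.
have := gamma_int_log_tangent c1 c0.
rewrite opprD addNKr mulN1r gamma_intS// expRN mulrAC.
rewrite -[leRHS]mul1r ler_pM2r ?gamma_int_gt0// ler_pdivrMr ?expR_gt0// mul1r => h.
by rewrite -ler_expR lnK ?posrE.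
Qed.

Lemma digammaS c : 0 < c -> digamma (c + 1) = digamma c + c^-1.
Proof.
move=> c0; rewrite /digamma gamma_log_intS// gamma_intS//.
by field; rewrite !lt0r_neq0 ?gamma_int_gt0.
Qed.

Lemma digammaDn c n : 0 < c ->
  digamma (c + n%:R) = digamma c + \sum_(i < n) (c + i%:R)^-1.
Proof.
move=> c0; elim: n => [|n IH]; first by rewrite big_ord0 !addr0.
rewrite big_ord_recr/= addrA -IH -natr1 addrA digammaS//.
by rewrite ltr_pwDl.
Qed.

Lemma gamma_intDn c n : 0 < c ->
  gamma_int (c + n%:R) = gamma_int c * \prod_(i < n) (c + i%:R).
Proof.
move=> c0; elim: n => [|n IH]; first by rewrite big_ord0 addr0 mulr1.
rewrite big_ord_recr/= mulrA -IH -natr1 addrA gamma_intS; first exact: mulrC.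
by rewrite ltr_pwDl.
Qed.

Lemma gamma_int_fact n : gamma_int (n.+1%:R : R) = n`!%:R.
Proof.
elim: n => [|n IH]; first exact: gamma_int1.
by rewrite -natr1 gamma_intS// IH factS natrM.
Qed.

Lemma cvg_lnB_lnn c : 0 <= c ->
  ln (c + n.+1%:R) - ln n.+1%:R @[n --> \oo] --> (0 : R).
Proof.
move=> c0.
have ch : c * n.+1%:R^-1 @[n --> \oo] --> (0 : R).
  by rewrite -(mulr0 c); apply: cvgMr; exact: cvg_harmonic.
apply: (squeeze_cvgr _ (cvg_cst 0) ch); apply: nearW => n.
have n0 : (0 : R) < n.+1%:R by [].
have cn0 : 0 < c + n.+1%:R by rewrite ltr_wpDl.
rewrite subr_ge0 ler_ln ?posrE// lerDr c0/=.
rewrite -ln_div ?posrE// mulrDl divff ?lt0r_neq0// addrC.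
rewrite -ler_expR lnK ?expR_ge1Dx// posrE.
by rewrite ltr_pwDl// divr_ge0.
Qed.

Definition gauss_gamma a n : R :=
  n`!%:R * n%:R `^ a * (\prod_(i < n.+1) (a + i%:R))^-1.

Lemma prodD_gt0 a n : 0 < a -> 0 < \prod_(i < n) (a + i%:R).
Proof. by move=> a0; apply: prodr_gt0 => i _; rewrite ltr_pwDl. Qed.

(** The log-tangent at [k + 1], evaluated at [a + k + 1], with [k = n + 1]; its
    slope is at least [ln k]. *)
Lemma gauss_gamma_le a n : 0 < a -> gauss_gamma a n.+1 <= gamma_int a.
Proof.
move=> a0; set k := n.+1.
have k0 : (0 : R) < k%:R by [].
have ak0 : 0 < a + k.+1%:R by rewrite ltr_pwDl.
rewrite ler_pdivrMr ?prodD_gt0// -gamma_intDn//.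
apply: (le_trans _ (gamma_int_log_tangent (ltr0Sn R k) ak0)).
rewrite gamma_int_fact ler_wpM2l ?ler0n// addrK powR_expR_ln// ler_expR.
by rewrite (ler_wpM2l (ltW a0))// -natr1 ln_le_digammaS.
Qed.

(** The log-tangent at [a + k + 1], evaluated at [k + 1], with [k = n + 1]; its
    slope is at most [ln (a + k + 1)]. The correction factor is the power
    [(k / (a + k + 1))^a], which tends to [1]. *)
Lemma gauss_gamma_ge a n : 0 < a ->
  gamma_int a * expR (- (a * (ln ((a + 1) + n.+1%:R) - ln n.+1%:R)))
    <= gauss_gamma a n.+1.
Proof.
move=> a0; set k := n.+1.
have k0 : (0 : R) < k%:R by [].
have ak0 : 0 < a + k.+1%:R by rewrite ltr_pwDl.
rewrite ler_pdivlMr ?prodD_gt0// mulrAC -gamma_intDn//.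
have := gamma_int_log_tangent ak0 (ltr0Sn R k).
rewrite gamma_int_fact => H.
have -> : - (a * (ln ((a + 1) + k%:R) - ln k%:R))
    = - (a * ln (a + k.+1%:R)) + a * ln k%:R.
  by rewrite (addrAC a 1) -addrA natr1; ring.
rewrite expRD mulrA powR_expR_ln// ler_wpM2r ?expR_ge0//.
apply: le_trans H.
rewrite (ler_wpM2l (ltW (gamma_int_gt0 ak0)))// ler_expR.
have -> : k.+1%:R - (a + k.+1%:R) = - a by ring.
rewrite mulNr lerN2 (ler_wpM2l (ltW a0))//.
exact: digamma_le_ln.
Qed.

Lemma cvg_gauss_gamma a : 0 < a -> gauss_gamma a n @[n --> \oo] --> gamma_int a.
Proof.
move=> a0; rewrite -(cvg_shiftS (gauss_gamma a)).
have a1 : 0 <= a + 1 by lra.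
have cl : gamma_int a * expR (- (a * (ln ((a + 1) + n.+1%:R) - ln n.+1%:R)))
    @[n --> \oo] --> gamma_int a.
  rewrite [X in _ --> X](_ : _ = gamma_int a * expR (- (a * 0))); last first.
    by rewrite mulr0 oppr0 expR0 mulr1.
  apply: cvgMr; apply: continuous_cvg; first exact: continuous_expR.
  by apply: cvgN; apply: cvgMr; exact: cvg_lnB_lnn.
apply: (squeeze_cvgr _ cl (cvg_cst _)).
by apply: nearW => n; rewrite gauss_gamma_ge// gauss_gamma_le.
Qed.

(** By [digammaDn] the difference from the limit is
    [ln n - digamma (a + n + 1)], and the digamma value lies between
    [ln (a + n)] and [ln (a + n + 1)]. *)
Lemma cvg_digamma a : 0 < a ->
  ln n%:R - \sum_(i < n.+1) (a + i%:R)^-1 @[n --> \oo] --> digamma a.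
Proof.
move=> a0.
have -> : (fun n => ln n%:R - \sum_(i < n.+1) (a + i%:R)^-1) =
    (fun n => digamma a + (ln n%:R - digamma (a + n.+1%:R))).
  by apply/funext => n; rewrite digammaDn//; ring.
rewrite -[X in _ --> X]addr0; apply: cvgD; first exact: cvg_cst.
rewrite -(cvg_shiftS (fun n => ln n%:R - digamma (a + n.+1%:R))).
have a1 : 0 <= a + 1 by lra.
have cl : - (ln (a + 1 + n.+1%:R) - ln n.+1%:R) @[n --> \oo] --> (0 : R).
  by rewrite -oppr0; apply: cvgN; exact: cvg_lnB_lnn.
have cu : - (ln (a + n.+1%:R) - ln n.+1%:R) @[n --> \oo] --> (0 : R).
  by rewrite -oppr0; apply: cvgN; apply: cvg_lnB_lnn; exact: ltW.
apply: (squeeze_cvgr _ cl cu); apply: nearW => n.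
have an : 0 < a + n.+1%:R by rewrite ltr_pwDl.
have an2 : 0 < a + n.+2%:R by rewrite ltr_pwDl.
have := ln_le_digammaS an; have := digamma_le_ln an2.
rewrite -addrA natr1 (addrAC a 1) -(addrA a _ 1) natr1 /=.
by move=> h1 h2; apply/andP; split; lra.
Qed.

End GaussLimit.

(** * Gauss products of dual numbers *)

Section DualGauss.
Variable R : realType.
Implicit Types (a b t : R) (n : nat) (x l m : dual R).

Lemma dual_natE n : n%:R = Dual n%:R 0 :> dual R.
Proof.
elim: n => [//|n IH]; rewrite -natr1 IH -[in RHS]natr1.
by congr Dual; rewrite /= addr0.
Qed.

Lemma dual_addE (r1 r2 d1 d2 : R) : Dual r1 d1 + Dual r2 d2 = Dual (r1 + r2) (d1 + d2).
Proof. by []. Qed.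

Lemma dual_mulE (r1 r2 d1 d2 : R) :
  Dual r1 d1 * Dual r2 d2 = Dual (r1 * r2) (r1 * d2 + d1 * r2).
Proof. by []. Qed.

Lemma dual_invE (r d : R) : r != 0 -> (Dual r d)^-1 = Dual r^-1 (- d / r ^+ 2).
Proof. by move=> r0; rewrite {1}/GRing.inv /= /dual_inv /= r0. Qed.

Lemma dual_powE t (a b : R) :
  dual_pow t (Dual a b) = Dual (t `^ a) (t `^ a * (b * ln t)).
Proof. by congr Dual => /=; ring. Qed.

Lemma dual_cvgM (f g : nat -> dual R) l m : dual_cvg f l -> dual_cvg g m ->
  dual_cvg (fun n => f n * g n) (l * m).
Proof.
move=> [fr fd] [gr gd]; split; first exact: cvgM.
by apply: cvgD; apply: cvgM.
Qed.

(** Used to discard index [0], at which [n%:R] is not invertible and the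
    sequences take junk values. *)
Lemma dual_cvg_eventually (f g : nat -> dual R) l :
  (forall n, f n.+1 = g n.+1) -> dual_cvg f l -> dual_cvg g l.
Proof.
move=> fg [fr fd]; split; [move: fr|move: fd]; apply: cvg_trans;
  apply: near_eq_cvg; near=> n; rewrite -(prednK (_ : 0 < n)%N) ?fg//;
  near: n; exact: nbhs_infty_gt.
Unshelve. all: end_near. Qed.

(** The dual part is the real part times its logarithmic derivative; this form
    is stable under products and inverses. *)
Lemma dual_prodE n (a b : R) : (forall i, a + i%:R != 0) ->
  \prod_(i < n) (Dual a b + i%:R) =
  Dual (\prod_(i < n) (a + i%:R))
       (\prod_(i < n) (a + i%:R) * (b * \sum_(i < n) (a + i%:R)^-1)).
Proof.
move=> ha; elim: n => [|n IH]; first by rewrite !big_ord0 !mulr0.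
rewrite !big_ord_recr/= IH dual_natE dual_addE dual_mulE; congr Dual.
by rewrite addr0; field; exact: ha.
Qed.

Definition dual_gauss x n : dual R :=
  n`!%:R * dual_pow n%:R x * (\prod_(i < n.+1) (x + i%:R))^-1.

Lemma dual_gaussE n (a b : R) : (forall i, a + i%:R != 0) ->
  dual_gauss (Dual a b) n =
  Dual (gauss_gamma a n)
       (gauss_gamma a n * (b * (ln n%:R - \sum_(i < n.+1) (a + i%:R)^-1))).
Proof.
move=> ha; rewrite /dual_gauss dual_prodE// dual_powE dual_natE dual_mulE.
have P0 : \prod_(i < n.+1) (a + i%:R) != 0.
  by apply/prodf_neq0 => i _; exact: ha.
rewrite dual_invE// dual_mulE /gauss_gamma; congr Dual; field; exact: P0.
Qed.

(** The integral of [e^-t t^(x - 1)] for dual [x], with the factor [ddu x] taken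
    out of the integral that gives the dual part. *)
Definition euler_dual x : dual R :=
  Dual (gamma_int (dre x)) (ddu x * gamma_log_int (dre x)).

Lemma cvg_dual_gauss_gt0 x : 0 < dre x -> dual_cvg (dual_gauss x) (euler_dual x).
Proof.
case: x => a b /= a0.
have ha (i : nat) : a + i%:R != 0 by apply: lt0r_neq0; rewrite ltr_pwDl.
have -> : dual_gauss (Dual a b) = fun n => Dual (gauss_gamma a n)
    (gauss_gamma a n * (b * (ln n%:R - \sum_(i < n.+1) (a + i%:R)^-1))).
  by apply/funext => n; exact: dual_gaussE.
split=> /=; first exact: cvg_gauss_gamma.
have -> : b * gamma_log_int a = gamma_int a * (b * digamma a).
  by rewrite /digamma; field; exact: lt0r_neq0 (gamma_int_gt0 a0).
apply: cvgM; first exact: cvg_gauss_gamma.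
by apply: cvgMr; exact: cvg_digamma.
Qed.

Definition nonpole x := forall i : nat, dre x + i%:R != 0.

Lemma dre_natr n : dre (n%:R : dual R) = n%:R.
Proof. by rewrite dual_natE. Qed.

Lemma nonpole_unit x i : nonpole x -> x + i%:R \is a GRing.unit.
Proof. by move=> /(_ i); rewrite dual_unitE /= dre_natr. Qed.

Lemma nonpoleS x : nonpole x -> nonpole (x + 1).
Proof. by move=> hx i; have := hx i.+1; rewrite -natr1 /= addrA addrAC. Qed.

Lemma dual_natr_unit n : (n.+1%:R : dual R) \is a GRing.unit.
Proof. by rewrite dual_unitE dre_natr. Qed.

Lemma cvg_dual_ratio x : dual_cvg (fun n => (x + n%:R) / n%:R) 1.
Proof.
case: x => a b.
apply: (@dual_cvg_eventually (fun n => Dual (1 + a * n%:R^-1) (b * n%:R^-1))).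
  move=> n; rewrite !dual_natE dual_addE dual_invE// dual_mulE.
  by congr Dual; field.
have h c : c * n%:R^-1 @[n --> \oo] --> (0 : R).
  rewrite -(mulr0 c); apply: cvgMr.
  by rewrite -(cvg_shiftS (fun n => n%:R^-1 : R)); exact: cvg_harmonic.
split; last exact: h.
by rewrite /= -[X in _ --> X]addr0; apply: cvgD; [exact: cvg_cst|exact: h].
Qed.

Lemma dual_powS t x : 0 < t -> dual_pow t (x + 1) = dual_pow t x * dual_of t.
Proof.
case: x => a b t0.
have -> : Dual a b + 1 = Dual (a + 1) (b + 0) by [].
rewrite !dual_powE dual_mulE addr0.
have -> : t `^ (a + 1) = t `^ a * t.
  by rewrite !powR_expR_ln// mulrDl mul1r expRD lnK ?posrE.
by congr Dual; ring.
Qed.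

(** The Gauss products at [x] and [x + 1] differ by the factor [x] and a ratio
    that tends to [1], so that convergence propagates from [x + 1] to [x]. *)
Lemma dual_gaussS x n : nonpole x ->
  dual_gauss (x + 1) n.+1 * x^-1 * ((x + 1 + n.+1%:R) / n.+1%:R)
    = dual_gauss x n.+1.
Proof.
move=> hx; set k := n.+1.
have uk : (k%:R : dual R) \is a GRing.unit by exact: dual_natr_unit.
have ux : x \is a GRing.unit by have := nonpole_unit 0 hx; rewrite addr0.
pose P := \prod_(i < k.+1) (x + i%:R); pose Q := \prod_(i < k.+1) (x + 1 + i%:R).
have uP : P \is a GRing.unit.
  by apply: rpred_prod => i _; exact: nonpole_unit.
have uQ : Q \is a GRing.unit.
  by apply: rpred_prod => i _; apply: nonpole_unit; exact: nonpoleS.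
have PQ : x * Q = P * (x + 1 + k%:R).
  transitivity (\prod_(i < k.+2) (x + i%:R)).
    rewrite big_ord_recl addr0; congr (_ * _); apply: eq_bigr => i _.
    by rewrite /bump/= natrD addrA.
  by rewrite big_ord_recr/= -[k.+1%:R]natr1 (addrC k%:R) addrA.
rewrite /dual_gauss -/P -/Q dual_powS ?ltr0n//.
have -> : dual_of k%:R = k%:R :> dual R by rewrite dual_natE.
have -> : P^-1 = Q^-1 * x^-1 * (x + 1 + k%:R).
  apply: (mulrI uP); rewrite divrr//.
  by rewrite mulrCA -PQ mulrA divrK ?mulVr.
rewrite -[RHS]mulr1 -[X in _ = _ * X](divrr uk).
by ring.
Qed.

Lemma cvg_dual_gauss x n : nonpole x -> 0 < dre x + n%:R ->
  dual_cvg (dual_gauss x) (euler_dual (x + n%:R) / shifted_factorial x n).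
Proof.
elim: n x => [|n IH] x hx xn.
  rewrite addr0 in xn.
  by rewrite addr0 /shifted_factorial big_ord0 divr1; exact: cvg_dual_gauss_gt0.
have ux : x \is a GRing.unit by have := nonpole_unit 0 hx; rewrite addr0.
have usf : shifted_factorial (x + 1) n \is a GRing.unit.
  by apply: rpred_prod => i _; apply: nonpole_unit; exact: nonpoleS.
have h : dual_cvg (fun=> x^-1) x^-1 by split; exact: cvg_cst.
have sf : shifted_factorial x n.+1 = x * shifted_factorial (x + 1) n.
  rewrite /shifted_factorial big_ord_recl addr0; congr (_ * _).
  by apply: eq_bigr => i _; rewrite /bump/= natrD addrA.
have -> : euler_dual (x + n.+1%:R) / shifted_factorial x n.+1 =
    euler_dual (x + 1 + n%:R) / shifted_factorial (x + 1) n * x^-1 * 1.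
  by rewrite sf invrM// mulr1 mulrA -addrA nat1r.
apply: dual_cvg_eventually (dual_cvgM
  (dual_cvgM (IH _ (nonpoleS hx) _) h) (cvg_dual_ratio (x + 1))).
  by move=> k; exact: dual_gaussS.
by rewrite /= -addrA nat1r.
Qed.

End DualGauss.

(** * Dual extensions of real functions and the dual gamma function *)

Section DualGamma.
Variable R : realType.
Implicit Types (a : R) (n : nat) (x y z : dual R) (f g : R -> R).

(** [y] is the value at [x] of the extension of [f] to dual numbers,
    [f (a + eps b) = f a + eps b f' a]. The product and quotient rules say that
    extending functions commutes with products and inverses. *)
Definition dual_value f x y :=
  dre y = f (dre x) /\
  exists2 d : R, is_derive (dre x) (1 : R) f d & ddu y = ddu x * d.

Lemma dual_valueE f x y : dual_value f x y ->
  y = Dual (f (dre x)) (ddu x * derive1 f (dre x)).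
Proof.
case: y => r d; rewrite /dual_value /= => -[-> [d' df ->]]; congr (Dual _ (_ * _)).
by rewrite derive1E; apply/esym/(@derive_val _ _ _ _ _ _ _ df).
Qed.

Lemma dual_value_near f g x y : {near dre x, f =1 g} ->
  dual_value f x y -> dual_value g x y.
Proof.
move=> fg [yf [d df dy]]; split; first by rewrite yf; exact: nbhs_singleton fg.
by exists d => //; exact: near_eq_is_derive fg df.
Qed.

Lemma dual_valueM f g x y z : dual_value f x y -> dual_value g x z ->
  dual_value (fun t => f t * g t) x (y * z).
Proof.
move=> [yf [df dfP ydf]] [zg [dg dgP zdg]]; split; first by rewrite /= yf zg.
exists (f (dre x) * dg + g (dre x) * df); first exact: is_deriveM.
by rewrite /= yf zg ydf zdg; ring.
Qed.

Lemma dual_valueV f x y : f (dre x) != 0 -> dual_value f x y ->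
  dual_value (fun t => (f t)^-1) x y^-1.
Proof.
case: y => r d f0; rewrite /dual_value /= => -[-> [d' df ->]].
rewrite dual_invE//; split=> //=.
exists (- (f (dre x)) ^- 2 *: d'); first exact: is_deriveV.
by rewrite /GRing.scale/=; field.
Qed.

Lemma dual_value_comp_addn f x y n : dual_value f (x + n%:R) y ->
  dual_value (fun t => f (t + n%:R)) x y.
Proof.
rewrite /dual_value dual_natE; case: x => a b /=; rewrite addr0.
move=> [ya [d df yd]]; split=> //; exists d => //.
have dg : is_derive a (1 : R) (fun t : R => t + n%:R) 1.
  by apply: is_derive_eq; rewrite addr0.
have := @is_derive1_comp _ f (fun t : R => t + n%:R) _ _ _ df dg.
by rewrite mulr1.
Qed.

Lemma dual_value_shifted_factorial x n :
  dual_value (fun t => shifted_factorial t n) x (shifted_factorial x n).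
Proof.
rewrite /shifted_factorial; elim: n => [|n IH].
  under eq_fun do rewrite big_ord0.
  rewrite big_ord0; split=> //.
  by exists 0; [exact: is_derive_cst|rewrite mulr0].
under eq_fun do rewrite big_ord_recr/=.
rewrite big_ord_recr/=; apply: dual_valueM => //.
apply: (@dual_value_comp_addn id); split=> //.
by exists 1; [exact: is_derive_id|rewrite mulr1].
Qed.

Lemma dual_value_gamma_int x : 0 < dre x ->
  dual_value (@gamma_int R) x (euler_dual x).
Proof.
by move=> x0; split=> //; exists (gamma_log_int (dre x)) => //;
  exact: is_derive_gamma_int.
Qed.

Lemma gamma_shift_gt0 a : 0 < a + (gamma_shift a)%:R.
Proof.
rewrite /gamma_shift; case: ifPn => [|_]; first by rewrite addr0.
by rewrite -ltrBlDl sub0r truncnS_gt.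
Qed.

(** Away from the poles the number of recurrence steps is locally constant, so
    that it does not contribute to the derivative of [gamma]. *)
Lemma gamma_shift_near a : a < 0 -> (forall i : nat, a + i%:R != 0) ->
  \forall t \near a, gamma_shift t = (Num.truncn (- a)).+1.
Proof.
move=> a0 ha; set m := Num.truncn (- a).
have /andP[ma am] : m%:R <= - a < m.+1%:R by apply: truncn_itv; rewrite oppr_ge0 ltW.
have {}ma : a < - m%:R.
  by rewrite lt_neqAle -lerNr ma andbT -addr_eq0; exact: ha.
have {}am : - m.+1%:R < a by rewrite ltrNl.
near=> t.
have t0 : t < 0 by near: t; exact: lt_nbhsl.
rewrite /gamma_shift ltNge (ltW t0) /=; congr _.+1; apply: truncn_def.
by rewrite lerNr ltrNl; apply/andP; split; [apply: ltW|];
  near: t; [exact: lt_nbhsl|exact: lt_nbhsr].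
Unshelve. all: end_near. Qed.

(** For [0 < dre x] this is the integral definition, for [dre x < 0] it is the
    quotient rule for [gamma], carried out by the division of dual numbers. *)
Lemma dual_gammaE x : nonpole x ->
  dual_gamma x = euler_dual (x + (gamma_shift (dre x))%:R) /
                 shifted_factorial x (gamma_shift (dre x)).
Proof.
move=> hx; have := gamma_shift_gt0 (dre x).
rewrite /dual_gamma; case: (ltrP 0 (dre x)) => [x0 _|xle0].
  rewrite /gamma_shift x0 addr0 /shifted_factorial big_ord0 divr1.
  rewrite /dual_int /euler_dual /gamma_int /gamma_log_int; congr Dual.
    by apply: eq_Rintegral => t _ /=; ring.
  rewrite -RintegralZl; [|exact: measurable_itv|exact: integrable_euler_kernel_ln].
  by apply: eq_Rintegral => t _ /=; rewrite /euler_kernel; ring.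
have xlt0 : dre x < 0.
  by rewrite lt_neqAle xle0 andbT -[dre x]addr0; exact: hx 0%N.
set n := gamma_shift _ => xn0.
have -> : forall r s : R, dual_of r + deps R * dual_of s = Dual r s.
  by move=> r s; rewrite -dualE.
apply/esym/dual_valueE.
apply: (@dual_value_near (fun t => gamma_int (t + n%:R) / shifted_factorial t n)).
  have En : n = (Num.truncn (- dre x)).+1.
    by rewrite /n /gamma_shift ltNge xle0.
  near=> t.
  have -> // : n = gamma_shift t.
  rewrite En; apply/esym; near: t; exact: gamma_shift_near.
apply: dual_valueM.
  by apply: dual_value_comp_addn; apply: dual_value_gamma_int; rewrite /= dre_natr.
apply: dual_valueV; last exact: dual_value_shifted_factorial.
by apply/prodf_neq0 => i _; exact: hx.
Unshelve. all: end_near. Qed.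

Lemma cvg_dual_gauss_dual_gamma x : nonpole x ->
  dual_cvg (dual_gauss x) (dual_gamma x).
Proof.
by move=> hx; rewrite dual_gammaE//; apply: cvg_dual_gauss => //; exact: gamma_shift_gt0.
Qed.

End DualGamma.

(** * The limit formulas *)

(* At k = 0 the sequences take junk values, which do not affect the limits. *)
Theorem theorem4p1 (R : realType) (a b : R)
    (ha : forall n : nat, a <> - n%:R) :
  let x : dual R := Dual a b in
  [/\ dual_cvg
        (fun k : nat => k`!%:R * dual_pow k%:R x
                        * (\prod_(i < k.+1) (x + i%:R))^-1)
        (dual_gamma x),
      dual_cvg
        (fun k : nat => dual_pow k%:R x * (k.-1)`!%:R
                        * (k%:R / (x + k%:R))
                        * (\prod_(i < k) (x + i%:R))^-1)
        (dual_gamma x)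
    & dual_cvg
        (fun k : nat => (k.-1)`!%:R * dual_pow k%:R x
                        / shifted_factorial x k)
        (dual_gamma x)].
Proof.
move=> x.
have hx : nonpole x by move=> i; rewrite addr_eq0; apply/eqP; exact: ha.
have G := cvg_dual_gauss_dual_gamma hx.
have ux k : \prod_(i < k) (x + i%:R) \is a GRing.unit.
  by apply: rpred_prod => i _; exact: nonpole_unit.
split; first exact: G.
  apply: dual_cvg_eventually G => k; rewrite /dual_gauss.
  rewrite factS natrM big_ord_recr/= invrM ?ux ?nonpole_unit//; ring.
rewrite -[dual_gamma x]mulr1.
apply: dual_cvg_eventually (dual_cvgM G (cvg_dual_ratio x)) => k.
rewrite /dual_gauss /shifted_factorial factS natrM big_ord_recr/=.
rewrite invrM ?ux ?nonpole_unit//.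
rewrite -[RHS]mulr1 -[X in _ = _ * X](divrr (dual_natr_unit R k)).
rewrite -[RHS]mulr1 -[X in _ = _ * X](divrr (nonpole_unit k.+1 hx)); ring.
Qed.
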